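(* Let $\alpha\in\mathbb{C}$ with $|\alpha|=1$ and $\alpha\ne\pm1$, let $n\ge 3$ be an integer, and let $1\le j\le n$. Then $\lambda_{\alpha,n,j}=g(\vartheta_{\alpha,n,j})$, where $$\vartheta_{\alpha,n,j}=\frac{j\pi}{n}-\frac{2}{n}\arctan\left(l_\alpha^{(-1)^j}\right).$$ Furthermore, $\vartheta_{\alpha,n,j}\in\left(\frac{(j-1)\pi}{n},\frac{j\pi}{n}\right)$, and the vector $v_{\alpha,n,j}=[v_{\alpha,n,j,k}]_{k=1}^n$ with components $$v_{\alpha,n,j,k}=\sin(k\vartheta_{\alpha,n,j})+\overline{\alpha}\,\sin((n-k)\vartheta_{\alpha,n,j})$$ is an eigenvector of $A_{\alpha,n}$ associated to $\lambda_{\alpha,n,j}$.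
   Context: For $\alpha\in\mathbb{C}$ and an integer $n\ge 3$, $A_{\alpha,n}$ is the $n\times n$ complex matrix with all main diagonal entries equal to $2$, all entries on the first subdiagonal and on the first superdiagonal equal to $-1$, the $(1,n)$ entry equal to $-\overline{\alpha}$, the $(n,1)$ entry equal to $-\alpha$, and all other entries $0$. It is Hermitian, and its (real) eigenvalues, counted with multiplicity, are enumerated in ascending order: $\lambda_{\alpha,n,1}\le\cdots\le\lambda_{\alpha,n,n}$. The function $g$ is $g(x)=4\sin^2(x/2)$, and $l_\alpha=\frac{|1-\alpha|}{|1+\alpha|}$. *)

(* Defs.v *)
From mathcomp Require Import all_boot all_order all_algebra.
From mathcomp Require Import reals trigo.
From mathcomp.real_closed Require Import complex.

Set Implicit Arguments.
Unset Strict Implicit.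
Unset Printing Implicit Defensive.

Import Order.TTheory GRing.Theory Num.Theory.

Local Open Scope ring_scope.
Local Open Scope complex_scope.

(* Row or column number k, counted from 1, is the ordinal of value k - 1. *)
Definition A_mx (R : realType) (alpha : R[i]) (n : nat) : 'M[R[i]]_n :=
  \matrix_(i < n, j < n)
    if i == j then 2
    else if (i.+1 == j :> nat) || (j.+1 == i :> nat) then -1
    else if (i == 0 :> nat) && (j == n.-1 :> nat) then - alpha^*
    else if (i == n.-1 :> nat) && (j == 0 :> nat) then - alpha
    else 0.

(* All roots of the characteristic polynomial, repeated according to
   multiplicity, in ascending order.  On [R[i]] the order [<=] is partial, but
   it is total on the real axis, which contains the spectrum of a Hermitian
   matrix. *)
Definition eigenvalues (R : realType) (n : nat) (M : 'M[R[i]]_n) : seq R[i] :=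
  sort <=%R (sval (closed_field_poly_normal (char_poly M))).

(* [lambda alpha n j] is the j-th smallest eigenvalue, counted from j = 1. *)
Definition lambda (R : realType) (alpha : R[i]) (n j : nat) : R[i] :=
  (eigenvalues (A_mx alpha n))`_j.-1.

Definition g (R : realType) (x : R) : R := 4 * sin (x / 2) ^+ 2.

(* The norm [`| |] of [R[i]] is valued in [R[i]]; [Normc.normc] is its
   real-valued counterpart. *)
Definition l (R : realType) (alpha : R[i]) : R :=
  Normc.normc (1 - alpha) / Normc.normc (1 + alpha).

(* The exponent [(-1) ^+ j] is an integer. *)
Definition theta (R : realType) (alpha : R[i]) (n j : nat) : R :=
  j%:R * pi / n%:R - 2 / n%:R * atan (l alpha ^ ((-1) ^+ j)).

Definition v (R : realType) (alpha : R[i]) (n j : nat) : 'cV[R[i]]_n :=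
  \col_(i < n)
    ((sin (i.+1%:R * theta alpha n j))%:C
     + alpha^* * (sin ((n - i.+1)%:R * theta alpha n j))%:C).

(* Main.v *)
Require Import Defs.
From mathcomp Require Import all_boot all_order all_algebra.
From mathcomp Require Import reals trigo.
From mathcomp.real_closed Require Import complex.
From mathcomp Require Import ring lra zify.

Import Order.TTheory GRing.Theory Num.Theory.

Local Open Scope ring_scope.
Local Open Scope complex_scope.

(** Away from its corners, [A_mx alpha n] acts as minus the discrete second
    difference, so a sequence [f] with [2 f (k+1) - f k - f (k+2) = mu f (k+1)]
    satisfies the interior rows with eigenvalue [mu].  The corner entries encode
    twisted periodicity: the first and last rows hold as soon as
    [f 0 = alpha^* f n] and [f (n+1) = alpha f 1] ([A_mx_mul_col]).

    The sequence [mode] is a combination of two sine waves of frequency [x], so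
    it obeys the recurrence with [mu = g x] ([mode_rec]), and it is built to
    satisfy the condition at 0 for every [x] ([mode0]).  When [alpha] lies on
    the unit circle, the condition at [n] amounts to
    [2 cos (n x) sin x = (alpha + alpha^* ) sin x], hence holds once
    [cos (n x) = Re alpha] ([modeS]).  The angles [theta] solve this equation:
    [n theta = j pi - 2 atan (l ^ (-1)^j)], and
    [l ^ 2 = (1 - Re alpha) / (1 + Re alpha)] makes the half-angle formula for
    [cos (2 atan _)] return [Re alpha] with the sign [(-1)^j]
    ([cos_natr_theta]).

    Since [2 atan] of a positive number lies strictly between 0 and [pi], the
    angle [theta] lies in the announced interval ([theta_itv]), and
    [sin (n theta)], which is the last component of the vector, does not vanish.
    So each [g (theta j)] is an eigenvalue.  As the intervals are disjoint and
    [g] increases on [0, pi], these are [n] distinct numbers in increasing order;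
    the characteristic polynomial has degree [n], so they are all its roots and
    their order is the sorted one ([eigenvaluesE]). *)

(** * The twisting parameter on the unit circle *)

Lemma sqr_normc_Re (R : rcfType) (z : R[i]) :
  Normc.normc z ^+ 2 = complex.Re z ^+ 2 + complex.Im z ^+ 2.
Proof. by case: z => a b; rewrite /= sqr_sqrtr // addr_ge0 ?sqr_ge0. Qed.

Lemma unit_circleE (R : rcfType) (alpha : R[i]) :
  `|alpha| = 1 -> complex.Re alpha ^+ 2 + complex.Im alpha ^+ 2 = 1.
Proof.
by move=> h; have := add_Re2_Im2 alpha; rewrite h expr1n => /complexI.
Qed.

Lemma normc_gt0 (R : rcfType) (z : R[i]) : z != 0 -> 0 < Normc.normc z.
Proof.
move=> z_neq0; rewrite lt0r; apply/andP; split.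
  by apply: contraNneq z_neq0 => /Normc.eq0_normc ->.
by case: z {z_neq0} => a b; exact: sqrtr_ge0.
Qed.

Lemma l_gt0 (R : realType) (alpha : R[i]) :
  alpha != 1 -> alpha != -1 -> 0 < l alpha.
Proof.
move=> h1 hN1; rewrite divr_gt0 // normc_gt0 //.
  by rewrite subr_eq0 eq_sym.
by rewrite addrC addr_eq0.
Qed.

(** Expanding [|1 + z| ^ 2] on the unit circle leaves only the real part, so the
    quotient [l] of two moduli becomes a function of [Re alpha] alone. *)
Lemma sqr_normc1D (R : rcfType) (z : R[i]) :
  `|z| = 1 -> Normc.normc (1 + z) ^+ 2 = 2 * (1 + complex.Re z).
Proof.
move=> /unit_circleE; rewrite sqr_normc_Re; case: z => a b /= h.
by rewrite add0r sqrrD expr1n -addrA h; ring.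
Qed.

Lemma Re_gtN1 (R : rcfType) (z : R[i]) :
  `|z| = 1 -> z != -1 -> 0 < 1 + complex.Re z.
Proof.
move=> z1 zN1; have : 0 < Normc.normc (1 + z).
  by rewrite normc_gt0 // addrC addr_eq0.
by move=> /(exprn_gt0 2); rewrite sqr_normc1D // pmulr_rgt0.
Qed.

Lemma sqr_lE (R : realType) (alpha : R[i]) : `|alpha| = 1 ->
  l alpha ^+ 2 = (1 - complex.Re alpha) / (1 + complex.Re alpha).
Proof.
move=> h; rewrite expr_div_n !sqr_normc1D ?normrN // -mulf_div divff ?mul1r //.
  by rewrite raddfN.
by rewrite pnatr_eq0.
Qed.

(** * The angles *)

Lemma cos_double_atan (R : realType) (x : R) :
  cos (2 * atan x) = (1 - x ^+ 2) / (1 + x ^+ 2).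
Proof.
have x2_gt0 : 0 < 1 + x ^+ 2 by have := sqr_ge0 x; lra.
rewrite mulr_natl cos_mulr2n cos_atan exprVn sqr_sqrtr ?ltW //.
by field; rewrite lt0r_neq0.
Qed.

Lemma double_atan_itv (R : realType) (x : R) :
  0 < x -> 0 < 2 * atan x < pi.
Proof.
move=> /(@lt_atan R); rewrite atan0 => atan_gt0.
by have := @atan_ltpi2 R x; lra.
Qed.

Lemma natr_theta (R : realType) (alpha : R[i]) (n j : nat) : (0 < n)%N ->
  n%:R * theta alpha n j = pi *+ j - 2 * atan (l alpha ^ ((-1) ^+ j)).
Proof.
move=> n_gt0; rewrite /theta -mulr_natl; field.
by rewrite pnatr_eq0 -lt0n.
Qed.

Lemma theta_itv (R : realType) (alpha : R[i]) (n j : nat) :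
    (0 < n)%N -> 0 < l alpha ->
  theta alpha n j \in `](j%:R - 1) * pi / n%:R, j%:R * pi / n%:R[.
Proof.
move=> n_gt0 l_pos; have nR_gt0 : 0 < n%:R :> R by rewrite ltr0n.
rewrite in_itv /= ltr_pdivrMr // ltr_pdivlMr //.
rewrite ![theta _ _ _ * _]mulrC natr_theta // -mulr_natl.
have := @double_atan_itv _ (l alpha ^ ((-1) ^+ j)).
by rewrite exprz_gt0 // => /(_ isT); lra.
Qed.

Lemma sin_natr_theta_neq0 (R : realType) (alpha : R[i]) (n j : nat) :
  (0 < n)%N -> 0 < l alpha -> sin (n%:R * theta alpha n j) != 0.
Proof.
move=> n_gt0 l_pos; rewrite natr_theta // addrC (alternatingn (@sinDpi R)).
rewrite mulf_neq0 ?signr_eq0 // sinN oppr_eq0 lt0r_neq0 // sin_gt0_pi //.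
by rewrite double_atan_itv // exprz_gt0.
Qed.

(** With [t = l ^ 2], replacing [t] by its inverse changes the sign of
    [(1 - t) / (1 + t)]; alternating the exponent of [l] thus cancels the sign
    [(-1)^j] coming from the shift by [j pi]. *)
Lemma cos_natr_theta (R : realType) (alpha : R[i]) (n j : nat) :
    (0 < n)%N -> `|alpha| = 1 -> alpha != 1 -> alpha != -1 ->
  cos (n%:R * theta alpha n j) = complex.Re alpha.
Proof.
move=> n_gt0 h h1 hN1; rewrite natr_theta // addrC (alternatingn (@cosDpi R)).
have p_gt0 := Re_gtN1 _ _ h hN1.
have m_gt0 : 0 < 1 - complex.Re alpha.
  by rewrite -raddfN Re_gtN1 ?normrN // eqr_oppLR opprK.
rewrite cosN cos_double_atan -signr_odd -[in l _ ^ _]signr_odd.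
case: (odd j); rewrite ?expr0z ?expr1z ?exprN1 ?exprVn ?sqr_lE //=;
  move: (complex.Re alpha) p_gt0 m_gt0 {h h1 hN1} => a p_gt0 m_gt0.
  by rewrite expr1; field; rewrite !lt0r_neq0 //; lra.
by rewrite expr0 mul1r; field; rewrite !lt0r_neq0 //; lra.
Qed.

(** * The action of the matrix on sequences *)

Lemma sum_delta_nat (K : pzRingType) (n k : nat) (F : nat -> K) :
  \sum_(j < n) (k == j :> nat)%:R * F j = (k < n)%:R * F k.
Proof.
case: ltnP => [lt_kn|le_nk].
  rewrite (bigD1 (Ordinal lt_kn)) //= eqxx big1 ?addr0 // => j.
  by rewrite -val_eqE eq_sym => /negbTE /= ->; rewrite mul0r.
rewrite mul0r big1 // => j _; rewrite gtn_eqF ?mul0r //.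
exact: leq_trans (ltn_ord j) le_nk.
Qed.

(** The nested conditionals of the matrix become a sum because no two of its
    positions coincide; this is where [3 <= n] matters, since for [n = 2] the
    corners would fall on the off-diagonals. *)
Lemma A_mx_deltaE (R : realType) (alpha : R[i]) (n : nat) (i j : 'I_n) :
    (3 <= n)%N ->
  A_mx alpha n i j =
    2 * (i == j :> nat)%:R - (i.+1 == j :> nat)%:R - (i == j.+1 :> nat)%:R
    - (i == 0 :> nat)%:R * alpha^* * (n.-1 == j :> nat)%:R
    - (i == n.-1 :> nat)%:R * alpha * (0 == j :> nat)%:R.
Proof.
move=> n_ge3; have lt_i := ltn_ord i; have lt_j := ltn_ord j.
rewrite mxE -val_eqE /=.
rewrite [(j.+1 == _)]eq_sym [(j == n.-1 :> nat)]eq_sym [(j == 0 :> nat)]eq_sym.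
case: (altP (i =P j :> nat)) => h1; case: (altP (i.+1 =P j :> nat)) => h2;
case: (altP (i =P j.+1 :> nat)) => h3; case: (altP (i =P 0 :> nat)) => h4;
case: (altP (n.-1 =P j :> nat)) => h5; case: (altP (i =P n.-1 :> nat)) => h6;
case: (altP (0 =P j :> nat)) => h7; try lia; rewrite /=; ring.
Qed.

(** The boundary conditions say that the corner entries supply exactly the terms
    [f 0] and [f n.+1] missing from the first and last rows. *)
Lemma A_mx_mul_col (R : realType) (alpha : R[i]) (n : nat) (f : nat -> R[i])
    (i : 'I_n) :
    (3 <= n)%N -> f 0 = alpha^* * f n -> f n.+1 = alpha * f 1 ->
  (A_mx alpha n *m \col_(k < n) f k.+1) i 0
    = 2 * f i.+1 - f i - f i.+2.
Proof.
move=> n_ge3 f0 fn1; have lt_i := ltn_ord i.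
have sum_pred : \sum_(j < n) (i == j.+1 :> nat)%:R * f j.+1 = (0 < i)%:R * f i.
  case: (i : nat) lt_i => [|k] lt_k; rewrite ?mul0r ?mul1r.
    by rewrite big1 // => j _; rewrite mul0r.
  by rewrite (sum_delta_nat _ _ _ (fun j => f j.+1)) ltnW // mul1r.
transitivity (2 * ((i < n)%:R * f i.+1) - (i.+1 < n)%:R * f i.+2
   - (0 < i)%:R * f i
   - (i == 0 :> nat)%:R * alpha^* * ((n.-1 < n)%:R * f n.-1.+1)
   - (i == n.-1 :> nat)%:R * alpha * ((0 < n)%:R * f 1)).
  rewrite -sum_pred -!(sum_delta_nat _ _ _ (fun j => f j.+1)) mxE.
  rewrite !mulr_sumr -!sumrB; apply: eq_bigr => j _.
  by rewrite A_mx_deltaE // mxE; ring.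
have n_gt0 : (0 < n)%N by rewrite (leq_trans _ n_ge3).
have fiE : f i = (0 < i)%:R * f i + (i == 0 :> nat)%:R * f 0.
  by case: (i : nat) => [|k]; rewrite !(mul0r, mul1r, add0r, addr0).
have fi2E : f i.+2 = (i.+1 < n)%:R * f i.+2 + (i == n.-1 :> nat)%:R * f n.+1.
  case: (eqVneq (i : nat) n.-1) => [->|ne_in].
    by rewrite prednK // ltnn mul0r add0r mul1r.
  by have -> : (i.+1 < n)%N; [lia | rewrite mul1r mul0r addr0].
rewrite [f i in RHS]fiE [f i.+2 in RHS]fi2E lt_i n_gt0 prednK // leqnn.
by rewrite f0 fn1 !mul1r; ring.
Qed.

(** * The spectrum *)

(** The library's [eigenvalue] concerns row vectors; for a column eigenvector the
    singularity of [M - a%:M] gives the root directly. *)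
Lemma eigenvector_root_char_poly (F : fieldType) (n : nat) (M : 'M[F]_n)
    (a : F) (w : 'cV[F]_n) :
  w != 0 -> M *m w = a *: w -> root (char_poly M) a.
Proof.
move=> w_neq0 Mw; rewrite -eigenvalue_root_char /eigenvalue /eigenspace.
rewrite kermx_eq0 row_free_unit; apply: contraNN w_neq0 => unit_Ma.
by rewrite -[w](mulKmx unit_Ma) mulmxBl Mw mul_scalar_mx subrr mulmx0.
Qed.

(** [n] distinct roots exhaust a polynomial of degree [n].  The order of [R[i]]
    is only partial, but all these roots are real, so sorting them depends only
    on their multiset. *)
Lemma eigenvaluesE (R : realType) (n : nat) (M : 'M[R[i]]_n) (s : seq R) :
    sorted <%R s -> size s = n ->
    (forall x, x \in s -> root (char_poly M) x%:C) ->
  eigenvalues M = map (real_complex R) s.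
Proof.
move=> s_sorted s_size s_root; rewrite /eigenvalues.
case: closed_field_poly_normal => r /=.
rewrite (monicP (char_poly_monic M)) scale1r => char_polyE.
have r_size : size r = n.
  by apply/succn_inj; rewrite -(size_char_poly M) char_polyE size_prod_XsubC.
have sC_uniq : uniq (map (real_complex R) s).
  by rewrite (map_inj_uniq (@complexI R)) lt_sorted_uniq.
have sC_sub : {subset map (real_complex R) s <= r}.
  by move=> _ /mapP[x /s_root + ->]; rewrite char_polyE root_prod_XsubC.
have [size_eq mem_eq] : (size (map (real_complex R) s) = size r) *
    (map (real_complex R) s =i r).
  by apply: uniq_min_size => //; rewrite size_map s_size r_size.
have sC_perm : perm_eq (map (real_complex R) s) r.
  by rewrite uniq_perm // -(eq_uniq size_eq mem_eq).
have sC_real : {in map (real_complex R) s, forall z, z \is Num.real}.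
  by move=> _ /mapP[x _ ->]; rewrite complex_real.
have <- : sort <=%R (map (real_complex R) s) = sort <=%R r.
  apply/perm_sort_inP => //.
  - by move=> x y /sC_real xr /sC_real yr; exact: real_leVge.
  - by move=> x y z _ _ _; exact: le_trans.
  - by move=> x y _ _; exact: le_anti.
apply: sort_le_id; rewrite sorted_map; apply: sub_sorted s_sorted => x y.
by rewrite /= lecR; exact: ltW.
Qed.

(** * Eigenvectors *)

Lemma gE (R : realType) (x : R) : g x = 2 * (1 - cos x).
Proof.
rewrite -[x in RHS](@divfK _ 2) ?pnatr_eq0 // mulr_natr cos_mulr2n /g.
by rewrite sin2cos2; ring.
Qed.

Lemma g_lt (R : realType) : {in `[0, pi] &, {homo @g R : x y / x < y}}.
Proof.
by move=> x y x_in y_in lt_xy; rewrite !gE ltr_pM2l // ltrD2l ltrN2 ltr_cos.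
Qed.

(** Subtracting in [R] rather than in [nat] lets the index go beyond [n], as the
    boundary condition at [n.+1] requires. *)
Definition mode {R : realType} (alpha : R[i]) (n : nat) (x : R) (k : nat)
    : R[i] :=
  (sin (k%:R * x))%:C + alpha^* * (sin ((n%:R - k%:R) * x))%:C.

Lemma mode0 (R : realType) (alpha : R[i]) (n : nat) (x : R) :
  mode alpha n x 0 = alpha^* * mode alpha n x n.
Proof. by rewrite /mode subr0 subrr !mul0r sin0 !(mulr0, addr0, add0r). Qed.

(** After using [alpha * alpha^* = 1] on the second sine, both sides differ by
    [sin x * (2 cos (n x) - (alpha + alpha^* ))]. *)
Lemma modeS (R : realType) (alpha : R[i]) (n : nat) (x : R) :
    `|alpha| = 1 -> cos (n%:R * x) = complex.Re alpha ->
  mode alpha n x n.+1 = alpha * mode alpha n x 1.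
Proof.
move=> h hcos; rewrite /mode mulrDr mulrA -sqr_normc h expr1n mul1r mul1r.
have -> : n.+1%:R * x = n%:R * x + x by rewrite -natr1; ring.
have -> : (n%:R - n.+1%:R) * x = - x by rewrite -natr1; ring.
have -> : (n%:R - 1) * x = n%:R * x - x by ring.
rewrite sinD sinB sinN hcos; case: alpha {h hcos} => a b.
by apply/eqP; rewrite eq_complex /=; apply/andP; split; apply/eqP; ring.
Qed.

Lemma mode_rec (R : realType) (alpha : R[i]) (n : nat) (x : R) (k : nat) :
  2 * mode alpha n x k.+1 - mode alpha n x k - mode alpha n x k.+2
    = (g x)%:C * mode alpha n x k.+1.
Proof.
have sin_rec (a : R) : sin (a - x) + sin (a + x) = 2 * sin a - g x * sin a.
  by rewrite gE sinB sinD; ring.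
have sC (a : R) : (sin (a + x))%:C =
    2 * (sin a)%:C - (g x)%:C * (sin a)%:C - (sin (a - x))%:C.
  rewrite -(rmorph_nat (real_complex R)) -!rmorphM -!rmorphB -sin_rec.
  by rewrite addrAC subrr add0r.
rewrite /mode.
have -> : k.+2%:R * x = k.+1%:R * x + x by rewrite -(natr1 k.+1); ring.
have -> : k%:R * x = k.+1%:R * x - x by rewrite -(natr1 k); ring.
have -> : (n%:R - k%:R) * x = (n%:R - k.+1%:R) * x + x.
  by rewrite -(natr1 k); ring.
have -> : (n%:R - k.+2%:R) * x = (n%:R - k.+1%:R) * x - x.
  by rewrite -(natr1 k.+1); ring.
by rewrite !sC; ring.
Qed.

Lemma vE (R : realType) (alpha : R[i]) (n j : nat) :
  v alpha n j = \col_(k < n) mode alpha n (theta alpha n j) k.+1.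
Proof. by apply/colP => k; rewrite !mxE /mode natrB // ltn_ord. Qed.

Theorem proposition10 (R : realType) (alpha : R[i]) (n j : nat)
    (halpha : `|alpha| = 1) (halpha1 : alpha != 1) (halphaN1 : alpha != -1)
    (hn : (3 <= n)%N) (hj : (1 <= j <= n)%N) :
  [/\ lambda alpha n j = (g (theta alpha n j))%:C,
      theta alpha n j \in `](j%:R - 1) * pi / n%:R, j%:R * pi / n%:R[,
      v alpha n j != 0
    & A_mx alpha n *m v alpha n j = lambda alpha n j *: v alpha n j].
Proof.
have n_gt0 : (0 < n)%N by rewrite (leq_trans _ hn).
have l_pos := l_gt0 _ _ halpha1 halphaN1.
have v_neq0 k : v alpha n k != 0.
  (* The last component of the vector is [sin (n theta)]. *)
  apply: contraNneq (sin_natr_theta_neq0 _ _ _ k n_gt0 l_pos) => v0.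
  have lt_n1n : (n.-1 < n)%N by rewrite prednK.
  have := congr1 (fun w : 'cV_n => w (Ordinal lt_n1n) 0) v0.
  rewrite vE !mxE /mode /= prednK // subrr mul0r sin0 mulr0 addr0.
  by move=> /complexI ->.
have Av k :
    A_mx alpha n *m v alpha n k = (g (theta alpha n k))%:C *: v alpha n k.
  apply/colP => i; rewrite vE A_mx_mul_col // ?mode_rec ?mxE //.
    exact: mode0.
  by apply: modeS => //; apply: cos_natr_theta.
pose s := [seq g (theta alpha n k.+1) | k <- iota 0 n].
have s_sorted : sorted <%R s.
  rewrite sorted_map; apply/(sortedP 0) => i; rewrite size_iota => lt_in.
  rewrite /= !nth_iota ?(ltnW lt_in) // !add0n.
  have nR_gt0 : 0 < n%:R :> R by rewrite ltr0n.
  have th_itv := theta_itv _ _ _ _ n_gt0 l_pos.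
  have th_pi k : (k < n)%N -> theta alpha n k.+1 \in `[0, pi].
    move=> lt_kn; have := th_itv k.+1; rewrite !in_itv /= => /andP[lb ub].
    apply/andP; split; apply: ltW.
      apply: le_lt_trans lb; rewrite -natr1 addrK.
      by rewrite !mulr_ge0 ?invr_ge0 ?pi_ge0.
    apply: lt_le_trans ub _; rewrite ler_pdivrMr // mulrC.
    by rewrite ler_pM2l ?pi_gt0 // ler_nat.
  apply: g_lt; rewrite ?th_pi ?(ltnW lt_in) //.
  have := th_itv i.+1; have := th_itv i.+2; rewrite !in_itv /=.
  rewrite -(natr1 i.+1) addrK => /andP[lb _] /andP[_ ub].
  exact: lt_trans ub lb.
have lambdaE : lambda alpha n j = (g (theta alpha n j))%:C.
  rewrite /lambda (eigenvaluesE _ _ _ s s_sorted) ?size_map ?size_iota //.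
    have lt_jn : (j.-1 < n)%N by case: j hj.
    rewrite (nth_map 0) ?size_map ?size_iota // (nth_map 0%N) ?size_iota //.
    by rewrite nth_iota // add0n prednK //; case/andP: hj.
  move=> _ /mapP[k _ ->].
  exact: eigenvector_root_char_poly (v_neq0 _) (Av _).
split=> //; first exact: theta_itv.
by rewrite lambdaE.
Qed.
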